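(* (a) There exist a finite left automorphic Moufang loop $Q_1$ and a half-automorphism of $Q_1$ that is neither an automorphism nor an anti-automorphism of $Q_1$. (b) There exist a finite automorphic loop $Q_2$ and a half-automorphism of $Q_2$ that is neither an automorphism nor an anti-automorphism of $Q_2$.
   Context: A loop is a set $Q$ with a binary operation $\cdot$ and a two-sided neutral element $1$ such that for each $a\in Q$ the left multiplication $L_a:x\mapsto ax$ and the right multiplication $R_a:x\mapsto xa$ are bijections of $Q$. A Moufang loop is a loop satisfying the (equivalent) Moufang identities, e.g. $(xy)(zx)=(x(yz))x$ for all $x,y,z$. Put $\ell_{x,y}=L_{xy}^{-1}\circ L_x\circ L_y$, $r_{x,y}=R_{xy}^{-1}\circ R_y\circ R_x$ and $T_x=L_x^{-1}\circ R_x$. A loop $Q$ is automorphic if $\ell_{x,y}$, $r_{x,y}$ and $T_x$ are automorphisms of $Q$ for all $x,y\in Q$, and left automorphic if all $\ell_{x,y}$ are automorphisms of $Q$. A half-automorphism of a loop $Q$ is a bijection $\tau:Q\to Q$ such that for all $x,y\in Q$ one has $\tau(xy)=\tau(x)\tau(y)$ or $\tau(xy)=\tau(y)\tau(x)$. An anti-automorphism is a bijection $\tau: Q\to Q$ with $\tau(xy)=\tau(y)\tau(x)$ for all $x,y$. *)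

(* Defs.v *)
From mathcomp Require Import all_boot.

Set Implicit Arguments.
Unset Strict Implicit.
Unset Printing Implicit Defensive.

Declare Scope loop_scope.
Delimit Scope loop_scope with loop.

(* A plain record rather than an extension of umagmaType: the join of UMagma
   and Finite cannot be declared once fingroup is loaded, because it lacks a
   join with finStarMonoidType. *)
Record finLoop := FinLoop {
  carrier :> finType;
  op : carrier -> carrier -> carrier;
  unit_elt : carrier;
  op1x : left_id unit_elt op;
  opx1 : right_id unit_elt op;
  Ltrans_bij : forall a, bijective (fun x => op a x);
  Rtrans_bij : forall a, bijective (fun x => op x a)
}.

Arguments op {f}.
Notation "x * y" := (op x y) : loop_scope.
Local Open Scope loop_scope.

Section Loop.
Variable Q : finLoop.
Implicit Types x y z : Q.

Definition Ltrans x : Q -> Q := fun y => x * y.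
Definition Rtrans x : Q -> Q := fun y => y * x.

Definition Ltrans_inv x : Q -> Q := invF (bij_inj (Ltrans_bij x)).
Definition Rtrans_inv x : Q -> Q := invF (bij_inj (Rtrans_bij x)).

Lemma LtransK x : cancel (Ltrans x) (Ltrans_inv x).
Proof. exact: invF_f. Qed.

Lemma Ltrans_invK x : cancel (Ltrans_inv x) (Ltrans x).
Proof. exact: (f_invF (bij_inj (Ltrans_bij x))). Qed.

Lemma RtransK x : cancel (Rtrans x) (Rtrans_inv x).
Proof. exact: invF_f. Qed.

Lemma Rtrans_invK x : cancel (Rtrans_inv x) (Rtrans x).
Proof. exact: (f_invF (bij_inj (Rtrans_bij x))). Qed.

Definition linner x y : Q -> Q := Ltrans_inv (x * y) \o Ltrans x \o Ltrans y.
Definition rinner x y : Q -> Q := Rtrans_inv (x * y) \o Rtrans y \o Rtrans x.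
Definition tinner x : Q -> Q := Ltrans_inv x \o Rtrans x.

Definition automorphism (f : Q -> Q) : Prop :=
  bijective f /\ forall x y, f (x * y) = f x * f y.

Definition anti_automorphism (f : Q -> Q) : Prop :=
  bijective f /\ forall x y, f (x * y) = f y * f x.

(* Which alternative holds may depend on the pair (x, y). *)
Definition half_automorphism (f : Q -> Q) : Prop :=
  bijective f /\ forall x y, f (x * y) = f x * f y \/ f (x * y) = f y * f x.

End Loop.

Definition moufang (Q : finLoop) : Prop :=
  forall x y z : Q, (x * y) * (z * x) = (x * (y * z)) * x.

Definition left_automorphic (Q : finLoop) : Prop :=
  forall x y : Q, automorphism (linner x y).

Definition automorphic (Q : finLoop) : Prop :=
  forall x y : Q,
    [/\ automorphism (linner x y), automorphism (rinner x y)
      & automorphism (tinner x)].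

(* Main.v *)
Require Import Defs.
From HB Require Import structures.
From mathcomp Require Import all_boot.
From mathcomp Require Import all_algebra ring.

(** (a) The units of the octonions form a central extension of [F_2^3] by the
    signs. Their associator is a determinant, so each left inner mapping changes
    signs by a linear character and is an automorphism. Two units commute exactly
    when they are linearly dependent and anticommute otherwise, so changing
    the sign of a single imaginary unit is a half-automorphism.

    (b) For a commutative ring [R] and a unit [a], let the dihedral-like loop on
    [F_2 x R] have the product [(i,u)(j,v) = (i+j, a^(ij) ((-1)^j u + v))]. Its
    inner mappings have the form [(k,w) |-> (k, b w + k c)], and such maps are
    automorphisms for every unit [b]. A ring automorphism [g] with [g a = - a]
    acts on the second coordinate as a half-automorphism that reverses exactly
    the products with [i = j = 1]. Take [R = F_3 x F_3], [a = (1,-1)] and for [g]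
    the exchange of coordinates. *)

Set Implicit Arguments.
Unset Strict Implicit.
Unset Printing Implicit Defensive.

Import GRing.Theory.

(** * Inner mappings with a known formula *)

Section InnerMappings.
Local Open Scope loop_scope.
Variable Q : finLoop.
Implicit Types (x y : Q) (f g : Q -> Q).

Lemma eq_automorphism f g : f =1 g -> automorphism f -> automorphism g.
Proof.
move=> fg [bf fM]; split=> [|x y]; first exact: eq_bij bf _ fg.
by rewrite -!fg fM.
Qed.

(** Cancelling the translation by [x * y] identifies [f] with the inner mapping, so no inverse has
    to be computed. *)
Lemma linner_automorphism x y f :
    automorphism f -> (forall z, (x * y) * f z = x * (y * z)) ->
  automorphism (linner x y).
Proof.
move=> autf eq_f; apply: eq_automorphism autf => z.
by rewrite /linner /= /Ltrans -eq_f -/(Ltrans _ _) LtransK.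
Qed.

Lemma rinner_automorphism x y f :
    automorphism f -> (forall z, f z * (x * y) = (z * x) * y) ->
  automorphism (rinner x y).
Proof.
move=> autf eq_f; apply: eq_automorphism autf => z.
by rewrite /rinner /= /Rtrans -eq_f -/(Rtrans _ _) RtransK.
Qed.

Lemma tinner_automorphism x f :
  automorphism f -> (forall z, x * f z = z * x) -> automorphism (tinner x).
Proof.
move=> autf eq_f; apply: eq_automorphism autf => z.
by rewrite /tinner /= /Rtrans -eq_f -/(Ltrans _ _) LtransK.
Qed.

End InnerMappings.

(** * The octonion units *)

Definition F2cube : Type := bool * bool * bool.

Definition addv (a b : F2cube) : F2cube :=
  let: (a1, a2, a3) := a in let: (b1, b2, b3) := b in
  (a1 (+) b1, a2 (+) b2, a3 (+) b3).

(* The octonions are the group algebra of [F_2^3] twisted by the sign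
   [(-1)^oct_cocycle a b] (Albuquerque and Majid). *)
Definition oct_cocycle (a b : F2cube) : bool :=
  let: (a1, a2, a3) := a in let: (b1, b2, b3) := b in
  [&& a1, a2 & b3] (+) [&& a1, b2 & a3] (+) [&& b1, a2 & a3]
  (+) (a1 && (b1 (+) b2 (+) b3)) (+) (a2 && (b2 (+) b3)) (+) (a3 && b3).

(** Expansion along the row [c]; over [F_2] the signs of the minors disappear. *)
Definition det3 (a b c : F2cube) : bool :=
  let: (a1, a2, a3) := a in let: (b1, b2, b3) := b in
  let: (c1, c2, c3) := c in
  (((a2 && b3) (+) (a3 && b2)) && c1) (+)
  (((a1 && b3) (+) (a3 && b1)) && c2) (+)
  (((a1 && b2) (+) (a2 && b1)) && c3).

Lemma det3D a b c d : det3 a b (addv c d) = det3 a b c (+) det3 a b d.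
Proof.
case: a b c d => [[? ?] ?] [[? ?] ?] [[c1 c2] c3] [[d1 d2] d3] /=.
by rewrite !andb_addr [LHS](AC (2*2*2) ((1*3*5)*(2*4*6))).
Qed.

Definition octunit : Type := bool * F2cube.

Definition oct_mul (x y : octunit) : octunit :=
  (x.1 (+) y.1 (+) oct_cocycle x.2 y.2, addv x.2 y.2).

Definition oct_one : octunit := (false, (false, false, false)).

Lemma oct_mul1x : left_id oct_one oct_mul.
Proof. by case=> s [[[] []] []]; case: s. Qed.

Lemma oct_mulx1 : right_id oct_one oct_mul.
Proof. by case=> s [[[] []] []]; case: s. Qed.

Lemma addvK a : involutive (addv a).
Proof. by case: a => [[? ?] ?] [[? ?] ?]; rewrite /= !addKb. Qed.

Lemma addvC a b : addv a b = addv b a.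
Proof.
by case: a b => [[a1 a2] a3] [[b1 b2] b3]; congr (_, _, _); apply: addbC.
Qed.

Lemma addvA a b c : addv a (addv b c) = addv (addv a b) c.
Proof.
case: a b c => [[? ?] ?] [[? ?] ?] [[? ?] ?].
by congr (_, _, _); apply: addbA.
Qed.

Lemma oct_Ltrans_bij a : bijective (fun x => oct_mul a x).
Proof.
apply: injF_bij => -[s x] [t y] [/= eq1 /(can_inj (addvK _)) eqxy].
by move: eq1; rewrite eqxy => /addIb/addbI->.
Qed.

Lemma oct_Rtrans_bij a : bijective (fun x => oct_mul x a).
Proof.
apply: injF_bij => -[s x] [t y] [/= eq1]; rewrite ![addv _ a.2]addvC.
by move=> /(can_inj (addvK _)) eqxy; move: eq1; rewrite eqxy => /addIb/addIb->.
Qed.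

Definition octLoop : finLoop :=
  FinLoop oct_mul1x oct_mulx1 oct_Ltrans_bij oct_Rtrans_bij.

(** The bilinear terms of [oct_cocycle] have zero coboundary; polarizing the cubic terms in the
    first argument gives the determinant. *)
Lemma oct_cocycle_associator a b c :
  oct_cocycle (addv a b) c (+) oct_cocycle a b (+) oct_cocycle b c
    (+) oct_cocycle a (addv b c) = det3 a b c.
Proof.
case: a b c => [[a1 a2] a3] [[b1 b2] b3] [[c1 c2] c3].
by case: a1 a2 a3 b1 b2 b3 c1 c2 c3 => [] [] [] [] [] [] [] [] [].
Qed.

Definition sign_change (e : F2cube -> bool) (x : octunit) : octunit :=
  (x.1 (+) e x.2, x.2).

Lemma sign_changeK e : involutive (sign_change e).
Proof. by case=> s a; rewrite /sign_change /= addbK. Qed.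

Lemma sign_change_automorphism e :
    (forall a b, e (addv a b) = e a (+) e b) ->
  @automorphism octLoop (sign_change e).
Proof.
move=> eD; split=> [|[s a] [t b]]; first exact: inv_bij (sign_changeK e).
rewrite /sign_change /= /oct_mul /= eD; congr (_, _).
by case: s t (e a) (e b) (oct_cocycle a b) => [] [] [] [] [].
Qed.

Lemma oct_left_automorphic : left_automorphic octLoop.
Proof.
move=> [s a] [t b].
apply: (@linner_automorphism octLoop _ _ (sign_change (det3 a b))).
  by apply: sign_change_automorphism => c d; apply: det3D.
move=> [r c]; rewrite /= /oct_mul /sign_change /=.
rewrite -oct_cocycle_associator addvA; congr (_, _).
move: (oct_cocycle (addv a b) c) (oct_cocycle a b) (oct_cocycle b c).
move: (oct_cocycle a (addv b c)) => [] [] [] [].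
all: by case: s t r => [] [] [].
Qed.

Lemma oct_cocycle_moufang a b c :
  oct_cocycle a b (+) oct_cocycle c a (+) oct_cocycle (addv a b) (addv c a) =
  oct_cocycle b c (+) oct_cocycle a (addv b c)
    (+) oct_cocycle (addv a (addv b c)) a.
Proof.
case: a b c => [[a1 a2] a3] [[b1 b2] b3] [[c1 c2] c3].
by case: a1 a2 a3 b1 b2 b3 c1 c2 c3 => [] [] [] [] [] [] [] [] [].
Qed.

Lemma oct_moufang : moufang octLoop.
Proof.
move=> [s a] [t b] [r c]; rewrite /= /oct_mul /=; congr (_, _).
  (* The signs of the factors, equal on both sides, are grouped apart from the cocycle terms. *)
  rewrite [LHS](AC (3*3*1) ((1*2*4*5)*(3*6*7))).
  rewrite [RHS](AC (1*3*1*1*1) ((1*2*3*6)*(4*5*7))) /=.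
  by rewrite oct_cocycle_moufang.
by rewrite !addvA.
Qed.

Definition octunit_flip : octunit -> octunit :=
  sign_change (pred1 (true, false, false)).

(** For dependent indices the sign changes cancel, the origin not being flipped. Units with
    independent indices anticommute, so the two orders give both signs. *)
Lemma octunit_flip_half_automorphism : @half_automorphism octLoop octunit_flip.
Proof.
split=> [|[s a] [t b]]; first exact: inv_bij (sign_changeK _).
case: a b => [[a1 a2] a3] [[b1 b2] b3].
case: a1 a2 a3 b1 b2 b3 => [] [] [] [] [] [].
all: by case: s t => [] []; (left; reflexivity) || (right; reflexivity).
Qed.

Lemma octunit_flip_not_automorphism : ~ @automorphism octLoop octunit_flip.
Proof.
(* Two unflipped units whose product is, up to sign, the flipped one. *)
by case=> _ /(_ (false, (true, true, false)) (false, (false, true, false))).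
Qed.

Lemma octunit_flip_not_anti_automorphism :
  ~ @anti_automorphism octLoop octunit_flip.
Proof.
(* Two anticommuting units; neither they nor their product are flipped. *)
by case=> _ /(_ (false, (false, true, true)) (false, (false, true, false))).
Qed.

(** * Dihedral-like automorphic loops *)

Section DihedralLoop.
Local Open Scope ring_scope.
Variables (R : finComUnitRingType) (a : R).
Hypothesis Ua : a \is a GRing.unit.

Let aV : a * a^-1 = 1. Proof. exact: mulrV. Qed.

Definition dih_mul (x y : bool * R) : bool * R :=
  (x.1 (+) y.1,
   (if x.1 && y.1 then a else 1) * ((if y.1 then - x.2 else x.2) + y.2)).

Lemma dih_mul1x : left_id (false, 0) dih_mul.
Proof. by case=> [[] u]; rewrite /dih_mul /= ?oppr0 add0r mul1r. Qed.

Lemma dih_mulx1 : right_id (false, 0) dih_mul.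
Proof. by case=> [[] u]; rewrite /dih_mul /= addr0 mul1r. Qed.

Let scale_inj (i : bool) : injective ( *%R (if i then a else 1)).
Proof. by apply: mulrI; case: i; rewrite ?unitr1. Qed.

Lemma dih_Ltrans_bij x : bijective (fun y => dih_mul x y).
Proof.
apply: injF_bij => -[j v] [j' v'] [/addbI <-] /scale_inj.
by move=> /addrI ->.
Qed.

Lemma dih_Rtrans_bij x : bijective (fun y => dih_mul y x).
Proof.
apply: injF_bij => -[j v] [j' v'] [/addIb <-] /scale_inj /addIr /=.
by case: ifP => _ => [/oppr_inj|] ->.
Qed.

Definition dihLoop : finLoop :=
  FinLoop dih_mul1x dih_mulx1 dih_Ltrans_bij dih_Rtrans_bij.

Definition dih_aff (b c : R) (x : bool * R) : bool * R :=
  (x.1, b * x.2 + (if x.1 then c else 0)).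

(** For two first coordinates [true] the shifts [- c] and [c] cancel; otherwise at most one shift
    occurs. *)
Lemma dih_aff_automorphism b c :
  b \is a GRing.unit -> @automorphism dihLoop (dih_aff b c).
Proof.
move=> Ub; split=> [|[[] u] [[] v]].
- by apply: injF_bij => -[i u] [j v] [<-] /addIr /(mulrI Ub) ->.
all: by rewrite /dih_aff /= /dih_mul /=; congr (_, _); ring.
Qed.

Lemma dih_automorphic : automorphic dihLoop.
Proof.
move=> [i u] [j v]; split.
(* Solving [(x * y) * f z = x * (y * z)] gives [b] and [c]; [v] cancels. *)
- pose b := if i && j then a else 1.
  pose c := if j then if i then u - a * u else a^-1 * u - u else 0.
  apply: (@linner_automorphism dihLoop _ _ (dih_aff b c)).
    by apply: dih_aff_automorphism; rewrite /b; case: ifP; rewrite ?unitr1.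
  by case=> [[] w]; rewrite /b /c; case: (i); case: (j);
     rewrite /= /dih_mul /dih_aff /=; congr (_, _); ring: aV.
- pose b := if i && j then a else 1.
  pose c := if i then if j then v - a * v else v - a^-1 * v else 0.
  apply: (@rinner_automorphism dihLoop _ _ (dih_aff b c)).
    by apply: dih_aff_automorphism; rewrite /b; case: ifP; rewrite ?unitr1.
  by case=> [[] w]; rewrite /b /c; case: (i); case: (j);
     rewrite /= /dih_mul /dih_aff /=; congr (_, _); ring: aV.
(* The power of [a] is common to [x * f z] and [z * x], so [a] does not enter. *)
- pose b : R := if i then -1 else 1.
  apply: (@tinner_automorphism dihLoop _ (dih_aff b (u + u))).
    by apply: dih_aff_automorphism; rewrite /b; case: (i); rewrite ?unitrN ?unitr1.
  by case=> [[] w]; rewrite /b; case: (i);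
     rewrite /= /dih_mul /dih_aff /=; congr (_, _); ring.
Qed.

Section HalfAutomorphism.
Variable g : {rmorphism R -> R}.
Hypotheses (g_bij : bijective g) (g_a : g a = - a).

Definition dih_map (x : bool * R) : bool * R := (x.1, g x.2).

Lemma dih_map_half_automorphism : @half_automorphism dihLoop dih_map.
Proof.
split=> [|[i u] [j v]].
  by apply: injF_bij => -[i u] [j v] [<-] /(bij_inj g_bij) ->.
(* For [i = j = 1] the sign from [g a = - a] turns [- g u + g v] into [- g v + g u]. *)
case: i j => [] []; [right | left..]; rewrite /dih_map /= /dih_mul /=.
all: by congr (_, _); rewrite rmorphM rmorphD ?rmorphN ?g_a ?rmorph1; ring.
Qed.

Hypothesis two_neq0 : 2%:R != 0 :> R.

Lemma dih_map_not_automorphism : ~ @automorphism dihLoop dih_map.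
Proof.
(* The product is [(false, a)], so multiplicativity would force [- a = a]. *)
case=> _ /(_ (true, 0) (true, 1)) [].
rewrite /= oppr0 !add0r !mulr1 rmorph1 rmorph0 oppr0 add0r mulr1 g_a.
move/eqP; rewrite eq_sym -addr_eq0 -mulr2n -mulr_natl.
by rewrite -(mul0r a) (can_eq (mulrK Ua)) (negbTE two_neq0).
Qed.

Lemma dih_map_not_anti_automorphism : ~ @anti_automorphism dihLoop dih_map.
Proof.
(* The two orders give [-1] and [1] in the second coordinate. *)
case=> _ /(_ (false, 1) (true, 0)) [].
rewrite /= addr0 !mul1r rmorphN rmorph0 rmorph1 add0r.
by move/eqP; rewrite eq_sym -addr_eq0 -mulr2n (negbTE two_neq0).
Qed.

End HalfAutomorphism.
End DihedralLoop.

(** * The exchange of coordinates as a ring automorphism *)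

Section Exchange.
Local Open Scope ring_scope.
Variable R : comNzRingType.

Definition exchange (x : R * R) : R * R := (x.2, x.1).

Lemma exchange_is_zmod_morphism : zmod_morphism exchange.
Proof. by []. Qed.

Lemma exchange_is_monoid_morphism : monoid_morphism exchange.
Proof. by []. Qed.

HB.instance Definition _ :=
  GRing.isZmodMorphism.Build (R * R)%type (R * R)%type exchange
    exchange_is_zmod_morphism.
HB.instance Definition _ :=
  GRing.isMonoidMorphism.Build (R * R)%type (R * R)%type exchange
    exchange_is_monoid_morphism.

Lemma exchange_bij : bijective exchange.
Proof. by apply: inv_bij; case. Qed.

End Exchange.

Theorem mainTheorem2 :
  (exists (Q1 : finLoop) (tau : Q1 -> Q1),
      left_automorphic Q1 /\ moufang Q1 /\ half_automorphism tau /\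
      ~ automorphism tau /\ ~ anti_automorphism tau) /\
  (exists (Q2 : finLoop) (tau : Q2 -> Q2),
      automorphic Q2 /\ half_automorphism tau /\
      ~ automorphism tau /\ ~ anti_automorphism tau).
Proof.
split.
  exists octLoop, octunit_flip; split; first exact: oct_left_automorphic.
  split; first exact: oct_moufang.
  split; first exact: octunit_flip_half_automorphism.
  split; first exact: octunit_flip_not_automorphism.
  exact: octunit_flip_not_anti_automorphism.
pose R : finComUnitRingType := HB.pack ('F_3 * 'F_3)%type.
pose a : R := (1, -1)%R.
have Ua : (a \is a GRing.unit)%R by [].
have g_bij := exchange_bij 'F_3.
have g_a : exchange a = (- a)%R by apply/eqP.
have two_neq0 : (2%:R != 0 :> R)%R by [].
exists (dihLoop Ua), (@dih_map R (exchange (R := 'F_3))).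
split; first exact: dih_automorphic.
split; first exact: dih_map_half_automorphism.
split; first exact: dih_map_not_automorphism.
exact: dih_map_not_anti_automorphism.
Qed.
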